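(* Let $(G,\cdot,N,\star,\odot)$ be a (finite) skew bracoid and let $M$ be an ideal of $(G,N)$. Then $(G,\cdot)$ acts on the quotient group $N/M$ via $g\odot(\eta M)=(g\odot\eta)M$ for $g\in G$, $\eta\in N$, and with this action $(G,N/M)$ is a skew bracoid.
   Context: All groups are finite. A (left) skew bracoid is a $5$-tuple $(G,\cdot,N,\star,\odot)$, also written $(G,N)$, such that $(G,\cdot)$ and $(N,\star)$ are groups and $\odot$ is a transitive action of $(G,\cdot)$ on the set $N$ such that $g\odot(\eta\star\mu)=(g\odot\eta)\star(g\odot e_N)^{-1}\star(g\odot\mu)$ for all $g\in G$ and $\eta,\mu\in N$, where $e_N$ is the identity of $N$ and inverses of elements of $N$ are taken in $(N,\star)$. Its $\gamma$-function is the homomorphism $\gamma:G\to\mathrm{Aut}(N)$ given by ${}^{\gamma(g)}\eta=(g\odot e_N)^{-1}\star(g\odot\eta)$. A left ideal of $(G,N)$ is a subgroup $M$ of $N$ with ${}^{\gamma(G)}M=M$; an ideal is a left ideal that is normal in $N$. *)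

(* Defs.v *)
From HB Require Import structures.
From mathcomp Require Import all_boot all_fingroup.

Set Implicit Arguments.
Unset Strict Implicit.
Unset Printing Implicit Defensive.

Import GroupScope.

(* MathComp's [{action aT &-> rT}] are right actions, so left actions are
   given directly as functions [act g x], read "g acting on x". *)
Record is_left_action (G : finGroupType) (T : Type) (act : G -> T -> T) : Prop :=
  IsLeftAction {
    left_act1 : forall x : T, act 1 x = x;
    left_actM : forall (g h : G) (x : T), act (g * h) x = act g (act h x)
  }.

Definition left_transitive (G : finGroupType) (T : Type) (act : G -> T -> T) : Prop :=
  forall x y : T, exists g : G, act g x = y.

Record is_skew_bracoid (G N : finGroupType) (act : G -> N -> N) : Prop :=
  IsSkewBracoid {
    bracoid_action : is_left_action act;
    bracoid_transitive : left_transitive act;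
    bracoid_law : forall (g : G) (eta mu : N),
      act g (eta * mu) = act g eta * (act g 1)^-1 * act g mu
  }.

Definition bracoid_gamma (G N : finGroupType) (act : G -> N -> N) (g : G) (eta : N) : N :=
  (act g 1)^-1 * act g eta.

Definition left_ideal (G N : finGroupType) (act : G -> N -> N) (M : {group N}) : Prop :=
  forall g : G, bracoid_gamma act g @: M = M.

Definition ideal (G N : finGroupType) (act : G -> N -> N) (M : {group N}) : Prop :=
  left_ideal act M /\ M <| [set: N].

(* Main.v *)
Require Import Defs.
From HB Require Import structures.
From mathcomp Require Import all_boot all_fingroup.

Set Implicit Arguments.
Unset Strict Implicit.
Unset Printing Implicit Defensive.

Import GroupScope.

(* The bracoid law reads [g . (eta mu) = (g . eta) gamma_g(mu)], so [g .] sends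
   the coset [eta M] into [(g . eta) M] as soon as [gamma_g(M) = M]. *)
Lemma coset_act_eq (G N : finGroupType) (act : G -> N -> N) (M : {group N})
    (hGN : is_skew_bracoid act) (hM : ideal act M) (g : G) (eta mu : N) :
  coset M eta = coset M mu -> coset M (act g eta) = coset M (act g mu).
Proof.
case: hM => hML /andP[_ nMN] eq_cosets.
have inN x : x \in 'N(M) by rewrite (subsetP nMN) ?inE.
have /rcosetP[m Mm ->] : eta \in M :* mu.
  by apply/rcoset_kercosetP.
(* The law applies [gamma_g] to the right factor only, so normality is used to rewrite [m * mu] as
   [mu * m ^ mu], with [m ^ mu] still in [M]. *)
have Mm' : m ^ mu \in M by rewrite memJ_norm.
rewrite conjgC (bracoid_law hGN) -mulgA morphM //=.
have Mgm : bracoid_gamma act g (m ^ mu) \in M.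
  by rewrite -(hML g) imset_f.
by rewrite -/(bracoid_gamma act g (m ^ mu)) (coset_id Mgm) mulg1.
Qed.

(* [coset_of M] consists of the cosets of M in its normaliser 'N(M); as M is
   normal in the whole group N, this is the full quotient group N / M, and
   [coset M eta] is the coset of any eta : N. *)
Theorem proposition3p13 (G N : finGroupType) (act : G -> N -> N) (M : {group N})
    (hGN : is_skew_bracoid act) (hM : ideal act M) :
  exists qact : G -> coset_of M -> coset_of M,
    (forall (g : G) (eta : N), qact g (coset M eta) = coset M (act g eta)) /\
    is_skew_bracoid qact.
Proof.
have [_ /andP[_ nMN]] := hM.
have inN x : x \in 'N(M) by rewrite (subsetP nMN) ?inE.
have [[act1 actM] act_trans act_law] := hGN.
(* The choice of [repr C] is harmless: by [coset_act_eq] any other representative gives the same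
   coset. *)
pose qact g (C : coset_of M) := coset M (act g (repr C)).
have qactE g eta : qact g (coset M eta) = coset M (act g eta).
  by apply: coset_act_eq => //; rewrite coset_reprK.
exists qact; split=> //; split; first split.
- by move=> C; rewrite /qact act1 coset_reprK.
- by move=> g h C; rewrite -(coset_reprK C) !qactE actM.
- move=> C D; have [g gCD] := act_trans (repr C) (repr D).
  by exists g; rewrite /qact gCD coset_reprK.
- move=> g C D; rewrite -(coset_reprK C) -(coset_reprK D) -morphM //=.
  (* The identity of [N / M] must be written as [coset M 1] for [qactE] to apply to [qact g 1]. *)
  by rewrite -(morph1 (coset M)) !qactE act_law !morphM ?morphV.
Qed.
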